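(* Let $(\mathbb{E},\circ,\bullet)$ be a Euclidean Jordan algebra of dimension $n$ and rank $\mathrm{rk}$, and let $m\ge1$ be an integer. Let $\{\mathcal{O}_r^{\mathrm{rk},m}\}_{r\in\mathbb{N}}$ be a sequence of closed convex cones in $\mathcal{S}^{\mathrm{rk},m}$ such that (i) $\mathcal{O}_{r+1}^{\mathrm{rk},m}\subseteq\mathcal{O}_r^{\mathrm{rk},m}$ for all $r\in\mathbb{N}$, and (ii) $\mathcal{COP}^{\mathrm{rk},m}=\bigcap_{r=0}^\infty\mathcal{O}_r^{\mathrm{rk},m}$. Let $\mathfrak{F}_{\rm c}(\mathbb{E})$ be a complete set of representatives of the $\mathfrak{S}_{\mathrm{rk}}$-orbits in $\mathfrak{F}(\mathbb{E})$ and fix a set $\mathfrak{F}$ with $\mathfrak{F}_{\rm c}(\mathbb{E})\subseteq\mathfrak{F}\subseteq\mathfrak{F}(\mathbb{E})$. Let $$\mathcal{O}_r^{n,m}(\mathbb{E}_+)=\bigcap_{(c_1,\dots,c_{\mathrm{rk}})\in\mathfrak{F}}\{\mathcal{A}\in\mathcal{S}^{n,m}(\mathbb{E})\mid\mathcal{A}(c_1,\dots,c_{\mathrm{rk}})\in\mathcal{O}_r^{\mathrm{rk},m}\}.$$ Then each $\mathcal{O}_r^{n,m}(\mathbb{E}_+)$ is a closed convex cone, $\mathcal{O}_{r+1}^{n,m}(\mathbb{E}_+)\subseteq\mathcal{O}_r^{n,m}(\mathbb{E}_+)$ for all $r\in\mathbb{N}$, and $\mathcal{COP}^{n,m}(\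mathbb{E}_+)=\bigcap_{r=0}^\infty\mathcal{O}_r^{n,m}(\mathbb{E}_+)$.
   Context: $\mathbb{N}$ is the set of nonnegative integers. A Euclidean Jordan algebra $(\mathbb{E},\circ,\bullet)$ is a finite-dimensional real vector space with a bilinear product $\circ$ such that $x\circ y=y\circ x$ and $x\circ((x\circ x)\circ y)=(x\circ x)\circ(x\circ y)$, having an identity element $e$ for $\circ$, together with a fixed inner product $\bullet$ satisfying $(x\circ y)\bullet z=x\bullet(y\circ z)$. Its symmetric cone is $\mathbb{E}_+=\{x\circ x\mid x\in\mathbb{E}\}$. An idempotent ($c\circ c=c$) is primitive if it is nonzero and not the sum of two nonzero idempotents. A Jordan frame is a system $c_1,\dots,c_k$ of primitive idempotents with $c_i\circ c_j=0$ for $i\ne j$ and $\sum_i c_i=e$; every Jordan frame has exactly $\mathrm{rk}$ elements ($\mathrm{rk}$ is the rank). $\mathfrak{F}(\mathbb{E})$ is the set of ordered Jordan frames $(c_1,\dots,c_{\mathrm{rk}})$; the symmetric group $\mathfrak{S}_{\mathrm{rk}}$ acts on it by $\sigma\cdot(c_1,\dots,c_{\mathrm{rk}})=(c_{\sigma(1)},\dots,c_{\sigma(\mathrm{rk})})$. $\mathcal{S}^{n,m}(\mathbb{E})$ is the space of symmetric tensors of order $m$ over $\mathbb{E}$ with the inner product $\langle\cdot,\cdot\rangle$ induced by $\bullet$ ($\langle x_1\otimes\cdots\otimes x_m,y_1\otimes\cdots\otimes y_m\rangle=\prod_i x_i\bullet y_i$); $\mathcal{S}^{k,m}=\mathcal{S}^{k,m}(\mathbb{R}^k)$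 with the standard inner product. $\mathcal{COP}^{n,m}(\mathbb{E}_+)=\{\mathcal{A}\in\mathcal{S}^{n,m}(\mathbb{E})\mid\langle\mathcal{A},x^{\otimes m}\rangle\ge0\ \forall x\in\mathbb{E}_+\}$, $\mathcal{COP}^{k,m}=\{\mathcal{B}\in\mathcal{S}^{k,m}\mid\langle\mathcal{B},\boldsymbol{x}^{\otimes m}\rangle\ge0\ \forall\boldsymbol{x}\in\mathbb{R}_+^k\}$. For $\mathcal{A}\in\mathcal{S}^{n,m}(\mathbb{E})$ and an ordered Jordan frame, $\mathcal{A}(c_1,\dots,c_{\mathrm{rk}})\in\mathcal{S}^{\mathrm{rk},m}$ is the tensor with $(i_1,\dots,i_m)$th element $\langle\mathcal{A},c_{i_1}\otimes\cdots\otimes c_{i_m}\rangle$. A cone is a nonempty set closed under multiplication by positive scalars. *)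

(* Defs.v *)
From HB Require Import structures.
From mathcomp Require Import all_boot all_order all_fingroup all_algebra.
From mathcomp Require Import all_classical all_reals all_analysis.

Set Implicit Arguments.
Unset Strict Implicit.
Unset Printing Implicit Defensive.

Import Order.TTheory GRing.Theory Num.Theory.
Import numFieldNormedType.Exports.

Local Open Scope classical_set_scope.
Local Open Scope ring_scope.

Record euclidean_jordan (R : realType) (E : vectType R) := EuclideanJordan {
  jmul : E -> E -> E;
  jone : E;
  jdot : E -> E -> R;
  jmulC : forall x y, jmul x y = jmul y x;
  jmul_linearl : forall (a : R) x y z,
    jmul (a *: x + y) z = a *: jmul x z + jmul y z;
  jmul_jordan : forall x y,
    jmul x (jmul (jmul x x) y) = jmul (jmul x x) (jmul x y);
  jmul1 : forall x, jmul jone x = x;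
  jdotC : forall x y, jdot x y = jdot y x;
  jdot_linearl : forall (a : R) x y z,
    jdot (a *: x + y) z = a * jdot x z + jdot y z;
  jdot_gt0 : forall x, x != 0 -> 0 < jdot x x;
  jdot_assoc : forall x y z, jdot (jmul x y) z = jdot x (jmul y z)
}.

Section JordanAlgebra.
Context {R : realType} {E : vectType R} (J : euclidean_jordan E).

Definition symmetric_cone : set E := [set x | exists y, x = jmul J y y].

Definition jidempotent (c : E) : Prop := jmul J c c = c.

Definition jprimitive (c : E) : Prop :=
  [/\ jidempotent c, c != 0 &
      ~ exists a b, [/\ jidempotent a, jidempotent b, a != 0, b != 0
                      & c = a + b]].

Definition jordan_frame (k : nat) (c : {ffun 'I_k -> E}) : Prop :=
  [/\ forall i, jprimitive (c i),
      forall i j, i != j -> jmul J (c i) (c j) = 0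
    & \sum_i c i = jone J].

Definition jpow (x : E) (i : nat) : E := iter i (jmul J x) (jone J).

Lemma jpow_dependent (x : E) : exists d, ~~ free (mkseq (jpow x) d.+1).
Proof.
exists (\dim {:E}); apply/negP; rewrite /free size_mkseq => /eqP H.
by have := dimvS (subvf <<mkseq (jpow x) (\dim {:E}).+1>>); rewrite H ltnn.
Qed.

(* The degree of the minimal polynomial of x. *)
Definition jdegree (x : E) : nat := ex_minn (jpow_dependent x).

(* The rank is the largest degree of a minimal polynomial; degrees never
   exceed the dimension, so the range of the maximum loses nothing. *)
Definition jrank : nat :=
  \max_(d < (\dim {:E}).+1 | `[< exists x, jdegree x = d >]) d.

Definition jordan_frames : set {ffun 'I_jrank -> E} := [set c | jordan_frame c].

End JordanAlgebra.
Arguments jordan_frames {R E} J.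

Definition frame_act (T : Type) (k : nat) (s : 'S_k) (c : {ffun 'I_k -> T}) :
  {ffun 'I_k -> T} := [ffun i => c (s i)].

Definition complete_representatives (T : Type) (k : nat)
    (F Fc : set {ffun 'I_k -> T}) : Prop :=
  Fc `<=` F /\
  forall c, F c -> exists! c', Fc c' /\ exists s : 'S_k, c' = frame_act s c.

(* Order-m tensors over a k-dimensional space, as arrays of coordinates. *)
Definition tensor (R : realType) (k m : nat) : Type :=
  {ffun 'I_m -> 'I_k} -> R^o.
HB.instance Definition _ (R : realType) (k m : nat) :=
  GRing.Lmodule.on (tensor R k m).

(* On these finite products of copies of R, the topology of pointwise
   convergence is the one induced by any inner product. *)
HB.instance Definition _ (R : realType) (k m : nat) :=
  Topological.copy (tensor R k m) {ptws {ffun 'I_m -> 'I_k} -> R^o}.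

Section Tensors.
Context {R : realType} {k m : nat}.
Implicit Types A B : tensor R k m.

Definition symtensor : set (tensor R k m) :=
  [set A | forall (s : 'S_m) (I : {ffun 'I_m -> 'I_k}),
     A [ffun j => I (s j)] = A I].

Definition tpure (x : 'I_m -> 'rV[R]_k) : tensor R k m :=
  fun I => \prod_j x j 0 (I j).

Definition tdot A B : R := \sum_I A I * B I.

Definition COP : set (tensor R k m) :=
  [set B | symtensor B /\
     forall x : 'rV[R]_k, (forall i, 0 <= x 0 i) ->
       0 <= tdot B (tpure (fun=> x))].

Definition cone (C : set (tensor R k m)) : Prop :=
  C !=set0 /\ forall (a : R) A, 0 < a -> C A -> C (a *: A).

Definition closed_convex_cone (C : set (tensor R k m)) : Prop :=
  [/\ closed C, convex_set C & cone C].

End Tensors.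
Arguments symtensor R k m : clear implicits.
Arguments COP R k m : clear implicits.

(* Tensors over E are written in the basis [vbasis fullv], which need not be
   orthonormal for the inner product of J; hence the Gram matrix in [jtdot]. *)
Section JordanTensors.
Context {R : realType} {E : vectType R} (J : euclidean_jordan E) {m : nat}.
Local Notation n := (\dim {:E}).
Local Notation b := (vbasis {:E}).

Definition jtpure (x : 'I_m -> E) : tensor R n m :=
  tpure (fun j => \row_i coord b i (x j)).

Definition jtdot (A B : tensor R n m) : R :=
  \sum_I \sum_K A I * B K * \prod_j jdot J b`_(I j) b`_(K j).

Lemma jdot_sum (I : finType) (a : I -> R) (v : I -> E) y :
  jdot J (\sum_i a i *: v i) y = \sum_i a i * jdot J (v i) y.
Proof.
have d0 : jdot J 0 y = 0.
  have := jdot_linearl J (-1) 0 0 y.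
  by rewrite scaler0 addr0 mulN1r addNr.
by elim/big_rec2 : _ => // i z1 z2 _ <-; rewrite jdot_linearl.
Qed.

(* The defining property of the inner product induced on tensors. *)
Lemma jtdot_pure (x y : 'I_m -> E) :
  jtdot (jtpure x) (jtpure y) = \prod_j jdot J (x j) (y j).
Proof.
have dE u v : jdot J u v =
    \sum_i \sum_l coord b i u * (coord b l v * jdot J b`_i b`_l).
  rewrite {1}(coord_vbasis (memvf u)) jdot_sum; apply: eq_bigr => i _.
  rewrite jdotC {1}(coord_vbasis (memvf v)) jdot_sum mulr_sumr.
  by apply: eq_bigr => l _; rewrite jdotC.
under [RHS]eq_bigr do rewrite dE.
rewrite bigA_distr_bigA /jtdot; apply: eq_bigr => I _ /=.
rewrite bigA_distr_bigA; apply: eq_bigr => K _ /=.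
rewrite /jtpure /tpure -!big_split /=; apply: eq_bigr => j _.
by rewrite !mxE mulrA.
Qed.

Definition jCOP : set (tensor R n m) :=
  [set A | symtensor R n m A /\
     forall x, symmetric_cone J x -> 0 <= jtdot A (jtpure (fun=> x))].

Definition frame_tensor (k : nat) (A : tensor R n m) (c : {ffun 'I_k -> E}) :
  tensor R k m := fun I => jtdot A (jtpure (fun j => c (I j))).

Definition jordan_outer (k : nat) (F : set {ffun 'I_k -> E})
    (O : set (tensor R k m)) : set (tensor R n m) :=
  symtensor R n m `&` \bigcap_(c in F) [set A | O (frame_tensor A c)].

End JordanTensors.
Arguments jCOP {R E} J m.

(* Main.v *)
Require Import Defs.
From HB Require Import structures.
From mathcomp Require Import all_boot all_order all_fingroup all_algebra.
From mathcomp Require Import all_classical all_reals all_analysis.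
From mathcomp Require Import complex ring lra.

Set Implicit Arguments.
Unset Strict Implicit.
Unset Printing Implicit Defensive.

Import Order.TTheory GRing.Theory Num.Theory.
Import numFieldNormedType.Exports.

Local Open Scope classical_set_scope.
Local Open Scope ring_scope.

(** By the spectral theorem every [x] in E is [\sum_i l_i *: c_i] for a Jordan
    frame [c], so the symmetric cone is the union over all frames of the cones
    [{\sum_i t_i *: c_i | t >= 0}].  As
    [<A, (\sum_i t_i *: c_i)^(tensor m)> = <A(c), t^(tensor m)>], the tensor [A]
    is copositive over the cone iff [A(c)] is copositive for every frame, and
    one ordering of each frame is enough.

    The spectral theorem: [x] generates an associative algebra, and since
    [u ** u + v ** v = 0] forces [u = v = 0] there, a polynomial killing [x] can
    be replaced by a product of distinct real linear factors; Lagrange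
    interpolation gives the idempotents, which are then split into primitive
    ones.  Two frames [c], [d] have the same size: for primitive [a], the
    eigenspace of [L(a)] at 1 is the line of [a], which makes
    [<a, d> / <a, a> = <a, d> / <d, d>] for primitive [a], [d]; summing over
    [c_i, d_j] gives both sizes.  Generic elements of a frame's span have degree
    equal to its size, so that size is the rank. *)

(** * Bilinear calculus, the linearized Jordan identity, idempotents *)

Section Jordan.
Context {R : realType} {E : vectType R} (J : euclidean_jordan E).
Local Notation "x ** y" := (jmul J x y) (at level 40, left associativity).
Local Notation dot := (jdot J).
Local Notation e := (jone J).
Implicit Types (x y z t u v w a b c d : E) (p q : {poly R}).

Lemma jmulDl x y z : (x + y) ** z = x ** z + y ** z.
Proof. by rewrite -[x]scale1r jmul_linearl !scale1r. Qed.

Lemma jmul0l z : 0 ** z = 0.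
Proof. by apply: (addrI (0 ** z)); rewrite -jmulDl !addr0. Qed.

Lemma jmulZl k x z : (k *: x) ** z = k *: (x ** z).
Proof. by rewrite -[k *: x]addr0 jmul_linearl jmul0l addr0. Qed.

Lemma jmulDr x y z : x ** (y + z) = x ** y + x ** z.
Proof. by rewrite !(jmulC J x) jmulDl. Qed.

Lemma jmul0r z : z ** 0 = 0.
Proof. by rewrite jmulC jmul0l. Qed.

Lemma jmulZr k x z : x ** (k *: z) = k *: (x ** z).
Proof. by rewrite jmulC jmulZl jmulC. Qed.

Lemma jmulNl x z : (- x) ** z = - (x ** z).
Proof. by rewrite -scaleN1r jmulZl scaleN1r. Qed.

Lemma jmulNr x z : x ** (- z) = - (x ** z).
Proof. by rewrite jmulC jmulNl jmulC. Qed.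

Lemma jmul_suml (I : Type) (r : seq I) (P : pred I) (F : I -> E) z :
  (\sum_(i <- r | P i) F i) ** z = \sum_(i <- r | P i) F i ** z.
Proof. exact: (big_morph _ (fun x y => jmulDl x y z) (jmul0l z)). Qed.

Lemma jmul_sumr (I : Type) (r : seq I) (P : pred I) (F : I -> E) z :
  z ** (\sum_(i <- r | P i) F i) = \sum_(i <- r | P i) z ** F i.
Proof. exact: (big_morph _ (fun x y => jmulDr z x y) (jmul0r z)). Qed.

Lemma jmul1r x : x ** e = x.
Proof. by rewrite jmulC jmul1. Qed.

Lemma jdotDl x y z : dot (x + y) z = dot x z + dot y z.
Proof. by rewrite -[x]scale1r jdot_linearl !scale1r mul1r. Qed.

Lemma jdot0l z : dot 0 z = 0.
Proof. by apply: (addrI (dot 0 z)); rewrite -jdotDl !addr0. Qed.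

Lemma jdotZl k x z : dot (k *: x) z = k * dot x z.
Proof. by rewrite -[k *: x]addr0 jdot_linearl jdot0l addr0. Qed.

Lemma jdotNl x z : dot (- x) z = - dot x z.
Proof. by rewrite -scaleN1r jdotZl mulN1r. Qed.

Lemma jdotDr x y z : dot x (y + z) = dot x y + dot x z.
Proof. by rewrite !(jdotC J x) jdotDl. Qed.

Lemma jdotZr k x z : dot x (k *: z) = k * dot x z.
Proof. by rewrite jdotC jdotZl jdotC. Qed.

Lemma jdotNr x z : dot x (- z) = - dot x z.
Proof. by rewrite jdotC jdotNl jdotC. Qed.

Lemma jdot_suml (I : Type) (r : seq I) (P : pred I) (F : I -> E) z :
  dot (\sum_(i <- r | P i) F i) z = \sum_(i <- r | P i) dot (F i) z.
Proof. exact: (big_morph _ (fun x y => jdotDl x y z) (jdot0l z)). Qed.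

Lemma jdot_sumr (I : Type) (r : seq I) (P : pred I) (F : I -> E) z :
  dot z (\sum_(i <- r | P i) F i) = \sum_(i <- r | P i) dot z (F i).
Proof. by rewrite jdotC jdot_suml; apply: eq_bigr => i _; rewrite jdotC. Qed.

Definition jdotE :=
  (jdotDl, jdotDr, jdotNl, jdotNr, jdotZl, jdotZr, jdot0l).
Definition jmulE :=
  (jmulDl, jmulDr, jmulNl, jmulNr, jmulZl, jmulZr, jmul0l, jmul0r).

Lemma jdot_eq0 x : dot x x = 0 -> x = 0.
Proof.
by move=> x0; apply/eqP; case: eqP => // /eqP/(jdot_gt0 J); rewrite x0 ltxx.
Qed.

Lemma jdot_ge0 x : 0 <= dot x x.
Proof.
by have [->|/(jdot_gt0 J)/ltW//] := eqVneq x 0; rewrite jdot0l.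
Qed.

(** Pairing with an arbitrary vector turns a linear identity in [E] into one over [R], where [lra]
    and [ring] apply; many proofs below end this way. *)
Lemma jdot_inj x y : (forall t, dot x t = dot y t) -> x = y.
Proof.
move=> xy; apply/eqP; rewrite -subr_eq0; apply/eqP/jdot_eq0.
by rewrite jdotDl jdotNl xy subrr.
Qed.

Lemma jdot_adj x y z : dot (x ** y) z = dot y (x ** z).
Proof. by rewrite (jmulC J x) jdot_assoc. Qed.

(** Polarization: the Jordan identity [H w] is cubic in [w], and the alternating sum of [H] over the
    partial sums of [x], [y], [z] isolates its trilinear part. *)
Lemma jordan_linearized x y z t :
  x ** ((y ** z) ** t) + y ** ((x ** z) ** t) + z ** ((x ** y) ** t) =
  (y ** z) ** (x ** t) + (x ** z) ** (y ** t) + (x ** y) ** (z ** t).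
Proof.
apply: jdot_inj => s.
have H w : dot (w ** ((w ** w) ** t)) s = dot ((w ** w) ** (w ** t)) s.
  by rewrite jmul_jordan.
move: (H (x + y + z)) (H (x + y)) (H (x + z)) (H (y + z)) (H x) (H y) (H z).
rewrite !(jmulE, jdotE) (jmulC J y x) (jmulC J z x) (jmulC J z y).
lra.
Qed.

(* The linearized Jordan identity, read as an operator identity in [z]. *)
Lemma jmul_mul3 x y t z :
  ((x ** y) ** t) ** z =
    (x ** t) ** (y ** z) + (y ** t) ** (x ** z) + (x ** y) ** (t ** z)
    - x ** (t ** (y ** z)) - y ** (t ** (x ** z)).
Proof.
have := jordan_linearized x y z t.
rewrite (jmulC J z t) (jmulC J z) !(jmulC J _ t) => H.
apply: jdot_inj => s; move: (congr1 (dot^~ s) H).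
rewrite !jdotE (jmulC J (t ** x)) (jmulC J (t ** y)).
rewrite (jmulC J (y ** z) (t ** x)) (jmulC J (x ** z) (t ** y)).
lra.
Qed.

Lemma jpowS x i : jpow J x i.+1 = x ** jpow J x i.
Proof. by []. Qed.

(** [jmul_mul3] writes [L(x^(i+2))] as a polynomial in [L(x)], [L(x^2)], [L(x^i)] and [L(x^(i+1))].
    The Jordan axiom says that [L(x)] commutes with [L(x^2)], and strong induction handles the other
    two. *)
Lemma jpow_comm x i z : x ** (jpow J x i ** z) = jpow J x i ** (x ** z).
Proof.
elim/ltn_ind: i z => -[|[|i]] IH z; first by rewrite !jmul1.
  by rewrite jpowS /= jmul1r.
have E2 s : jpow J x i.+2 ** s = (jpow J x i.+1 ** (x ** s)) *+ 2
    + (x ** x) ** (jpow J x i ** s)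
    - jpow J x i ** (x ** (x ** s)) - x ** (x ** (jpow J x i ** s)).
  have -> : jpow J x i.+2 = (jpow J x i ** x) ** x.
    by rewrite !jpowS !(jmulC J x).
  rewrite jmul_mul3 [jpow J x i ** x]jmulC -jpowS.
  apply: jdot_inj => r; rewrite mulr2n !jdotE; ring.
have IH0 := IH i (leqnSn _); have IH1 := IH i.+1 (leqnn _).
rewrite !E2 mulr2n !jmulE !IH1 !IH0 jmul_jordan !IH0; by [].
Qed.

(** This is [L(c) (2 L(c) - 1) (L(c) - 1) = 0], whence the possible eigenvalues 0, 1/2, 1. *)
Lemma jmul_idem3 c z : jidempotent J c ->
  2 *: (c ** (c ** (c ** z))) = 3 *: (c ** (c ** z)) - c ** z.
Proof.
move=> cc; have := jmul_mul3 c c c z; rewrite !cc => H.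
apply: jdot_inj => s; move: (congr1 (dot^~ s) H); rewrite !jdotE; lra.
Qed.

(* On the spectrum {0, 1/2, 1} of L(c), t = t^2 + 4 (t - t^2)^2. *)
Lemma jdot_idem_ge c z : jidempotent J c ->
  dot (c ** z) (c ** z) <= dot (c ** z) z.
Proof.
move=> cc; pose u := c ** z; pose v := c ** u.
have H3 := jmul_idem3 z cc; have H4 := congr1 (jmul J c) H3.
have : 0 <= dot (u - v) (u - v) by exact: jdot_ge0.
move: (congr1 (dot^~ z) H3) (congr1 (dot^~ z) H4).
rewrite !jmulE !jdotE -/u -/v.
have E1 : dot v z = dot u u by rewrite jdot_adj.
have E2 : dot (c ** v) z = dot u v by rewrite jdot_adj jdotC.
have E3 : dot (c ** (c ** v)) z = dot v v by rewrite jdot_adj jdot_adj.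
rewrite E1 E2 E3 (jdotC J v u); lra.
Qed.

Lemma jdot_idem c d : jidempotent J c -> jidempotent J d ->
  dot (c ** d) (c ** d) <= dot c d.
Proof.
move=> cc dd; have := jdot_idem_ge d cc.
by rewrite (jdot_assoc J c d d) dd.
Qed.

End Jordan.

(** * Polynomials evaluated at an element; a split annihilator with simple roots *)

Section Evaluation.
Context {R : realType} {E : vectType R} (J : euclidean_jordan E).
Local Notation "x ** y" := (jmul J x y) (at level 40, left associativity).
Local Notation dot := (jdot J).
Local Notation e := (jone J).
Implicit Types (x : E) (p q : {poly R}).

Definition jev x p : E := \sum_(i < size p) p`_i *: jpow J x i.

Lemma jev_wide n x p : (size p <= n)%N ->
  jev x p = \sum_(i < n) p`_i *: jpow J x i.
Proof.
move=> pn; rewrite /jev (big_ord_widen n (fun i => p`_i *: jpow J x i) pn).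
rewrite big_mkcond; apply: eq_bigr => i _.
by case: ltnP => // pi; rewrite nth_default// scale0r.
Qed.

Lemma jevD x p q : jev x (p + q) = jev x p + jev x q.
Proof.
set n := maxn (size p) (size q).
rewrite (@jev_wide n x (p + q)) ?size_polyD//.
rewrite (@jev_wide n x p) ?leq_maxl// (@jev_wide n x q) ?leq_maxr//.
by rewrite -big_split; apply: eq_bigr => i _; rewrite coefD scalerDl.
Qed.

Lemma jevZ x k p : jev x (k *: p) = k *: jev x p.
Proof.
rewrite (@jev_wide (size p) x (k *: p)) ?size_scale_leq// scaler_sumr.
by apply: eq_bigr => i _; rewrite coefZ scalerA.
Qed.

Lemma jevC x k : jev x k%:P = k *: e.
Proof.
by rewrite (@jev_wide 1) ?size_polyC ?leq_b1// big_ord1 coefC.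
Qed.

Lemma jev0 x : jev x 0 = 0.
Proof. by rewrite jevC scale0r. Qed.

Lemma jev_sum (I : Type) (r : seq I) (P : pred I) (F : I -> {poly R}) x :
  jev x (\sum_(i <- r | P i) F i) = \sum_(i <- r | P i) jev x (F i).
Proof. exact: (big_morph _ (jevD x) (jev0 x)). Qed.

Lemma jevMX x p : jev x (p * 'X) = x ** jev x p.
Proof.
rewrite (@jev_wide (size p).+1) ?(leq_trans (size_polyMleq _ _))//; last first.
  by rewrite size_polyX addn2.
rewrite big_ord_recl coefMX scale0r add0r jmul_sumr; apply: eq_bigr => i _.
by rewrite coefMX/= jmulZr.
Qed.

Lemma jevX x : jev x 'X = x.
Proof. by rewrite -['X]mul1r jevMX jevC scale1r jmul1r. Qed.

Lemma jev_comm x p (z : E) : x ** (jev x p ** z) = jev x p ** (x ** z).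
Proof.
rewrite !jmul_suml jmul_sumr; apply: eq_bigr => i _.
by rewrite !jmulZl jmulZr jpow_comm.
Qed.

(** Power associativity: by [jev_comm] a factor [x] moves past [jev x p], which is the inductive
    step on [q]. *)
Lemma jevM x p q : jev x (p * q) = jev x p ** jev x q.
Proof.
elim/poly_ind: q => [|q k IH]; first by rewrite mulr0 jev0 jmul0r.
rewrite mulrDr mulrA !jevD !jevMX IH jev_comm jmulDr jevC jmulZr jmul1r.
by rewrite mulrC mul_polyC jevZ.
Qed.

Lemma jev_normM x p q :
  dot (jev x (p * (p * q))) (jev x q) = dot (jev x (p * q)) (jev x (p * q)).
Proof. by rewrite jevM jdot_adj -jevM. Qed.

(** Pairing the hypothesis with [q(x)] gives [|(p q)(x)|^2 + k^2 |q(x)|^2 = 0], so the first term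
    vanishes. *)
Lemma jev_sum_sqr x p (k : R) q :
  jev x ((p ^+ 2 + (k ^+ 2)%:P) * q) = 0 -> jev x (p * q) = 0.
Proof.
move=> /(congr1 (fun v : E => dot v (jev x q))).
rewrite mulrDl jevD expr2 -mulrA jdotDl jev_normM jdot0l mul_polyC jevZ jdotZl.
have := jdot_ge0 J (jev x q); have := jdot_ge0 J (jev x (p * q)) => h1 h2 h.
apply: (@jdot_eq0 _ _ J); nra.
Qed.

Lemma jev_prod_sum_sqr (I : Type) (s : seq I) x (p : I -> {poly R}) (k : I -> R) q :
  jev x ((\prod_(i <- s) (p i ^+ 2 + (k i ^+ 2)%:P)) * q) = 0 ->
  jev x ((\prod_(i <- s) p i) * q) = 0.
Proof.
elim: s q => [|i s IH] q; first by rewrite !big_nil.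
rewrite !big_cons -mulrA => /jev_sum_sqr; rewrite mulrCA => /IH.
by rewrite mulrCA mulrA.
Qed.

(** Taking [k = 0] in [jev_sum_sqr] replaces a factor [p^2] by [p], so repeated roots can be removed
    one at a time. *)
Lemma jev_prod_undup (s : seq R) x q :
  jev x ((\prod_(i <- s) ('X - i%:P)) * q) = 0 ->
  jev x ((\prod_(i <- undup s) ('X - i%:P)) * q) = 0.
Proof.
elim: s q => [|i s IH] q; first by rewrite !big_nil.
rewrite big_cons -mulrA mulrCA => /IH {IH} /=.
case: ifP => [si|_]; last by rewrite big_cons mulrCA mulrA.
rewrite (big_rem i) ?mem_undup//= => H.
rewrite -mulrA; apply: (@jev_sum_sqr _ _ 0).
rewrite expr0n/= addr0 expr2 -mulrA -[RHS]H; congr (jev x _); ring.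
Qed.

Lemma jpow_dependentP x d : reflect
  (exists p, [/\ p != 0, (size p <= d.+1)%N & jev x p = 0])
  (~~ free (mkseq (jpow J x) d.+1)).
Proof.
have sz : size (mkseq (jpow J x) d.+1) == d.+1 by rewrite size_mkseq.
have nthx (j : 'I_d.+1) : (mkseq (jpow J x) d.+1)`_j = jpow J x j.
  by rewrite (nth_map 0%N) ?size_iota// nth_iota.
rewrite -[mkseq _ _]/(tval (Tuple sz)).
apply: (iffP idP) => [/negP nf|[p [p0 sp xp]]]; last first.
  apply/negP => /freeP/(_ (fun i => p`_i)) f; move/eqP: p0; apply; apply/polyP => i.
  rewrite coef0; have [id|di] := ltnP i d.+1; last first.
    by rewrite nth_default// (leq_trans sp).
  apply: (f _ (Ordinal id)); rewrite -[RHS]xp (@jev_wide d.+1)//.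
  by apply: eq_bigr => j _; rewrite nthx.
apply: contrapT => np; apply: nf; apply/freeP => k k0 i.
pose p := \poly_(j < d.+1) k (inord j).
have : p = 0.
  apply: contrapT => /eqP p0; apply: np; exists p; split => //.
    by rewrite size_poly.
  rewrite (@jev_wide d.+1) ?size_poly//; rewrite -[RHS]k0; apply: eq_bigr => j _.
  by rewrite coef_poly ltn_ord inord_val nthx.
move=> /(congr1 (fun r : {poly R} => r`_i)).
by rewrite coef_poly ltn_ord inord_val coef0.
Qed.

Lemma jdegree_leq x p d : p != 0 -> (size p <= d.+1)%N -> jev x p = 0 ->
  (jdegree J x <= d)%N.
Proof.
move=> p0 sp xp; rewrite /jdegree; case: ex_minnP => k _; apply.
by apply/jpow_dependentP; exists p.
Qed.

Lemma jdegree_annihilator x :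
  exists p, [/\ p != 0, (size p <= (jdegree J x).+1)%N & jev x p = 0].
Proof.
by rewrite /jdegree; case: ex_minnP => k /jpow_dependentP.
Qed.

(** Over the complex numbers, [p] is its own conjugate, so [p^2] is [p] times its conjugate. Each
    root [z] then contributes [(X - z)] times [(X - conj z)], which is [(X - Re z)^2 + (Im z)^2].
    Squaring [p] avoids having to pair conjugate roots. *)
Lemma poly_sqr_split p : p != 0 -> exists (s : seq (R * R)) (k : R),
  k != 0 /\ p ^+ 2 = k *: \prod_(z <- s) (('X - z.1%:P) ^+ 2 + (z.2 ^+ 2)%:P).
Proof.
move=> p0; pose rc := (real_complex R : {rmorphism R -> R[i]}).
have [r pr] := closed_field_poly_normal (map_poly rc p).
exists [seq (complex.Re z, complex.Im z) | z <- r], (lead_coef p ^+ 2).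
split; first by rewrite expf_neq0 // lead_coef_eq0.
pose cc := (@conjc R : {rmorphism R[i] -> R[i]}).
apply: (map_poly_inj rc).
have cjr k : cc (rc k) = rc k by exact: conjc_real.
have cj : map_poly cc (map_poly rc p) = map_poly rc p.
  by rewrite -map_poly_comp; apply: eq_map_poly => k; exact: cjr.
have -> : map_poly rc (p ^+ 2) = map_poly cc (map_poly rc p) * map_poly rc p.
  by rewrite cj expr2 rmorphM.
rewrite pr lead_coef_map.
rewrite !map_polyZ -scalerAl -scalerAr scalerA cjr -rmorphM -expr2.
congr (_ *: _); rewrite !rmorph_prod -big_split big_map.
apply: eq_bigr => -[a b] _.
rewrite !(rmorphD, rmorphN, rmorphXn) /= !map_polyX !map_polyC -!/rc -!/cc.
have -> : (a +i* b)%C = rc a + 'i%C * rc b :> R[i].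
  by apply/eqP; rewrite eq_complex /=; simpc; rewrite ?eqxx.
have cE : cc (rc a + 'i%C * rc b) = rc a - 'i%C * rc b.
  by apply/eqP; rewrite eq_complex /=; simpc; rewrite ?eqxx.
rewrite -[LHS]/(('X - (cc (rc a + 'i%C * rc b))%:P) * ('X - (rc a + 'i%C * rc b)%:P)).
rewrite -[RHS]/(('X - (rc a)%:P) ^+ 2 + (rc b)%:P ^+ 2) cE.
have i2 : ('i%C%:P : {poly R[i]}) ^+ 2 = -1.
  by rewrite -polyC_exp sqr_i polyCN.
rewrite !(polyCD, polyCN, polyCM).
ring: i2.
Qed.

Lemma jev_split_annihilator x :
  exists s : seq R, uniq s /\ jev x (\prod_(k <- s) ('X - k%:P)) = 0.
Proof.
have [p [p0 _ xp]] := jdegree_annihilator x.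
have [s [k [k0 ps]]] := poly_sqr_split p0.
(* The real parts of the complex roots: [jev_prod_sum_sqr] discards the imaginary parts,
   [jev_prod_undup] the repetitions. *)
exists (undup [seq z.1 | z <- s]); split; first exact: undup_uniq.
rewrite -[X in jev x X]mulr1; apply: jev_prod_undup.
rewrite big_map; apply: (@jev_prod_sum_sqr _ s x (fun z => 'X - z.1%:P) snd).
apply: (scalerI k0); rewrite scaler0 -jevZ mulr1 -ps expr2 jevM xp.
by rewrite jmul0l.
Qed.

End Evaluation.

(** * Spectral idempotents, Peirce eigenspaces, and the common size of frames *)

Section Spectral.
Context {R : realType} {E : vectType R} (J : euclidean_jordan E).
Local Notation "x ** y" := (jmul J x y) (at level 40, left associativity).
Local Notation dot := (jdot J).
Local Notation e := (jone J).
Local Notation n := (\dim {:E}).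
Implicit Types (x v a b d : E) (q : {poly R}) (k : nat).

(* The [c i] are the values at [x] of the Lagrange interpolation polynomials
   of the spectrum. *)
Lemma jlagrange x : exists k (c : 'I_k -> E) (l : 'I_k -> R),
  [/\ forall i, jidempotent J (c i), forall i j, i != j -> c i ** c j = 0,
      \sum_i c i = e, forall i, x ** c i = l i *: c i
    & forall i, exists q, c i = jev J x q].
Proof.
have [s [us sx]] := jev_split_annihilator J x.
pose l (i : 'I_(size s)) := s`_i.
have linj i j : i != j -> l i - l j != 0.
  by rewrite subr_eq0 /l nth_uniq.
pose w i : {poly R} := \prod_(j | j != i) ('X - (l j)%:P).
have ww i : w i * ('X - (l i)%:P) = \prod_(z <- s) ('X - z%:P).
  by rewrite [RHS](big_nth 0) big_mkord (bigD1 i)//= mulrC.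
have wl i : (w i).[l i] != 0.
  by rewrite horner_prod; apply/prodf_neq0 => j ji; rewrite !hornerE linj// eq_sym.
have wl0 i j : i != j -> (w i).[l j] = 0.
  by move=> ij; rewrite horner_prod (bigD1 j) 1?eq_sym//= !hornerE subrr mul0r.
pose g i := (w i).[l i]^-1 *: w i; pose c i := jev J x (g i).
have xc i : x ** c i = l i *: c i.
  have : jev J x (g i * ('X - (l i)%:P)) = 0.
    by rewrite -scalerAl ww jevZ sx scaler0.
  rewrite mulrBr [_ * _%:P]mulrC mul_polyC -scaleNr jevD jevMX.
  rewrite [jev J x (- l i *: _)]jevZ scaleNr.
  by move/eqP; rewrite subr_eq0 => /eqP.
have cc i j : i != j -> c i ** c j = 0.
  (* Moving [x] from one factor to the other, which [jevM] permits, gives [l i *: (c i ** c j) = l j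
     *: (c i ** c j)]. *)
  move=> ij; apply: (scalerI (linj _ _ ij)); rewrite scaler0 scalerBl.
  by rewrite -jmulZl -jmulZr -!xc /c -!jevMX -!jevM mulrAC mulrA subrr.
(* The polynomial [\sum_i g i - 1] vanishes at every point of [s], so the annihilating product
   divides it. *)
have sc : \sum_i c i = e.
  have [||q gq] := @uniq_roots_prod_XsubC _ (\sum_i g i - 1) s.
  - apply/allP => z /(nthP 0)[i si <-]; pose i' := Ordinal si.
    rewrite rootE -[s`_i]/(l i') hornerD hornerN hornerC horner_sum (bigD1 i')//=.
    rewrite hornerZ mulVf// big1 ?addr0 ?subrr// => j ji.
    by rewrite hornerZ (wl0 j i')// mulr0.
  - by rewrite uniq_rootsE.
  apply/eqP; rewrite -subr_eq0 -[e]scale1r -(jevC J x) -jev_sum.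
  by rewrite -scaleN1r -jevZ -jevD scaleN1r gq jevM sx jmul0r.
exists (size s), c, l; split => // [i|i]; last by exists (g i).
rewrite /jidempotent -[RHS](jmul1r J) -sc jmul_sumr (bigD1 i)//= big1 ?addr0//.
by move=> j ji; rewrite cc// eq_sym.
Qed.

(* Linearizing the Jordan identity at (v, a, a) gives [L(a), L(v)] = 0. *)
Lemma peirce_one_comm a v t : jidempotent J a -> a ** v = v ->
  a ** (v ** t) = v ** (a ** t).
Proof.
move=> aa av; have := jordan_linearized J v a a t.
rewrite (jmulC J v a) av aa => H; apply: (@jdot_inj _ _ J) => s.
move: (congr1 (dot^~ s) H); rewrite !jdotE; lra.
Qed.

(** The factor ['X] removes the constant term, because [L(a)] need not fix [e]. It fixes the
    positive powers of [v], since it commutes with [L(v)]. *)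
Lemma peirce_one_jev a v q : jidempotent J a -> a ** v = v ->
  a ** jev J v (q * 'X) = jev J v (q * 'X).
Proof.
move=> aa av; elim/poly_ind: q => [|q k IH].
  by rewrite mul0r jev0 jmul0r.
rewrite mulrDl jevD jmulDr jevMX peirce_one_comm// IH; congr (_ + _).
by rewrite mul_polyC jevZ jevX jmulZr av.
Qed.

(** A spectral idempotent [c i] of [v] with nonzero eigenvalue is a polynomial in [v] without
    constant term, so [L(a)] fixes it. Then [a - c i] is also idempotent, and primitivity leaves
    only [c i = 0] or [c i = a]. *)
Lemma primitive_peirce_one a v : jprimitive J a -> a ** v = v ->
  exists k : R, v = k *: a.
Proof.
move=> [aa a0 prim] av.
have [k [c [l [cc _ sc vc qc]]]] := jlagrange v.
have lc i : exists m : R, l i *: c i = m *: a.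
  have [->|l0] := eqVneq (l i) 0; first by exists 0; rewrite !scale0r.
  have [->|c0] := eqVneq (c i) 0; first by exists 0; rewrite scaler0 scale0r.
  exists (l i); congr (_ *: _); apply: contrapT => ca; apply: prim.
  have ac : a ** c i = c i.
    apply: (scalerI l0); rewrite -jmulZr -vc; have [q ->] := qc i.
    by rewrite -jevMX peirce_one_jev.
  exists (c i), (a - c i); split => //.
  - rewrite /jidempotent !jmulE aa ac (jmulC J (c i)) ac cc.
    by apply: (@jdot_inj _ _ J) => s; rewrite !jdotE; ring.
  - by rewrite subr_eq0 eq_sym; apply/eqP.
  - by rewrite addrC subrK.
exists (\sum_i sval (cid (lc i))).
rewrite scaler_suml -[LHS](jmul1r J) -sc jmul_sumr; apply: eq_bigr => i _.
by rewrite vc; case: cid.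
Qed.

(** By [jmul_idem3], [2 L(a)^2 d - L(a) d] is fixed by [L(a)], hence equals [m *: a]. Pairing with
    [a] determines [m]; pairing with [d] then gives the formula. *)
Lemma primitive_quadratic a d : jprimitive J a -> jidempotent J d ->
  2 * dot (a ** d) (a ** d) - dot a d = dot a d / dot a a * dot a d.
Proof.
move=> pa dd; have [aa a0 _] := pa.
have [m mP] : exists m, 2 *: (a ** (a ** d)) - a ** d = m *: a.
  apply: primitive_peirce_one => //; rewrite jmulDr jmulZr jmul_idem3// jmulNr.
  by apply: (@jdot_inj _ _ J) => s; rewrite !jdotE; lra.
have aa0 : dot a a != 0 by rewrite gt_eqF// jdot_gt0.
have -> : dot a d / dot a a = m.
  apply: (mulIf aa0); rewrite divfK// -jdotZl -mP !jdotE.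
  by rewrite !(jdot_adj J a) !aa (jdotC J a); ring.
have := congr1 (dot^~ d) mP; rewrite !jdotE jdot_adj => <-.
by rewrite (jdot_assoc J a d d) dd.
Qed.

(** The left side of [primitive_quadratic] is symmetric in [a] and [d]; equating the two right
    sides, [dot a d] cancels unless it is 0, when both quotients are 0. *)
Lemma primitive_dot_eq a d : jprimitive J a -> jprimitive J d ->
  dot a d / dot a a = dot a d / dot d d.
Proof.
move=> pa pd; have [aa a0 _] := pa; have [dd d0 _] := pd.
have := primitive_quadratic pd aa; have := primitive_quadratic pa dd.
rewrite (jmulC J d a) (jdotC J d a) => -> /eqP; rewrite -subr_eq0 -mulrBl mulf_eq0.
by case/orP => [|/eqP ->]; [rewrite subr_eq0 => /eqP | rewrite !mul0r].
Qed.

Lemma jordan_frame_dot_sum k (c : {ffun 'I_k -> E}) : jordan_frame J c ->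
  \sum_i dot (c i) e / dot (c i) (c i) = k%:R.
Proof.
move=> [pc _ _]; rewrite -[RHS]mulr1n -[X in X%:R]card_ord -sumr_const.
apply: eq_bigr => i _; have [cc c0 _] := pc i.
by rewrite -{1}cc jdot_assoc jmul1r divff// gt_eqF// jdot_gt0.
Qed.

Lemma jordan_frame_size k k' (c : {ffun 'I_k -> E}) (c' : {ffun 'I_k' -> E}) :
  jordan_frame J c -> jordan_frame J c' -> k = k'.
Proof.
move=> fc fc'; apply/eqP; rewrite -(eqr_nat R).
rewrite -(jordan_frame_dot_sum fc) -(jordan_frame_dot_sum fc').
have [pc _ sc] := fc; have [pc' _ sc'] := fc'.
under eq_bigr do rewrite -sc' jdot_sumr mulr_suml.
under [X in _ == X]eq_bigr do rewrite -sc jdot_sumr mulr_suml.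
rewrite exchange_big/=; apply/eqP; apply: eq_bigr => i _; apply: eq_bigr => j _.
by rewrite (jdotC J (c' i)) primitive_dot_eq.
Qed.

End Spectral.

(** * Refining orthogonal idempotents to frames, and the rank *)

Section Frames.
Context {R : realType} {E : vectType R} (J : euclidean_jordan E).
Local Notation "x ** y" := (jmul J x y) (at level 40, left associativity).
Local Notation dot := (jdot J).
Local Notation e := (jone J).
Local Notation n := (\dim {:E}).
Implicit Types (x v a b d : E) (p : {poly R}) (k : nat).

(** A Jordan frame without primitivity: what the spectral idempotents form before they are split. *)
Definition jorthosystem k (c : 'I_k -> E) : Prop :=
  [/\ forall i, jidempotent J (c i) /\ c i != 0,
      forall i j, i != j -> c i ** c j = 0 & \sum_i c i = e].

Lemma jidempotentD a b : jidempotent J a -> jidempotent J b ->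
  jidempotent J (a + b) -> a ** b = 0.
Proof.
rewrite /jidempotent => aa bb; rewrite !jmulE aa bb (jmulC J b) => H.
apply: (@jdot_inj _ _ J) => s; move: (congr1 (dot^~ s) H); rewrite !jdotE; lra.
Qed.

(** The numbers [dot a d] and [dot b d] sum to 0, and [jdot_idem] bounds them below by the squared
    norms of [a ** d] and [b ** d]. *)
Lemma jidempotentD_orth a b d : jidempotent J a -> jidempotent J b ->
  jidempotent J d -> (a + b) ** d = 0 -> a ** d = 0 /\ b ** d = 0.
Proof.
move=> aa bb dd abd.
have : dot a d + dot b d = 0.
  by rewrite -jdotDl -dd -jdot_assoc abd jdot0l.
have := jdot_idem aa dd; have := jdot_idem bb dd.
have := jdot_ge0 J (a ** d); have := jdot_ge0 J (b ** d) => h1 h2 h3 h4 h5.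
by split; apply: (@jdot_eq0 _ _ J); lra.
Qed.

Lemma jorthosystem_dot0 k (c : 'I_k -> E) i j : jorthosystem c -> i != j ->
  dot (c i) (c j) = 0.
Proof.
move=> [cc orth _] ij; have [<- _] := cc i.
by rewrite jdot_assoc orth// jdotC jdot0l.
Qed.

Lemma jorthosystem_coef k (c : 'I_k -> E) (l : 'I_k -> R) i :
  jorthosystem c -> \sum_j l j *: c j = 0 -> l i = 0.
Proof.
move=> oc /(congr1 (dot^~ (c i))); rewrite jdot0l jdot_suml (bigD1 i)//= big1.
  rewrite addr0 jdotZl => /eqP; rewrite mulf_eq0 => /orP[/eqP//|].
  by have [/(_ i)[_ c0] _ _] := oc; rewrite gt_eqF// jdot_gt0.
by move=> j ji; rewrite jdotZl (jorthosystem_dot0 oc)// mulr0.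
Qed.

Lemma jorthosystem_size k (c : 'I_k -> E) : jorthosystem c -> (k <= n)%N.
Proof.
move=> oc; have fc : free [tuple c i | i < k].
  apply/freeP => l; under eq_bigr do rewrite -tnth_nth tnth_mktuple.
  by move=> l0 i; exact: jorthosystem_coef oc l0.
have := dimvS (subvf <<[tuple c i | i < k]>>).
by rewrite (eqP fc) size_tuple.
Qed.

(** [a] takes the place of [c i] and [b] becomes the new member at [ord0]; both stay orthogonal to
    the others by [jidempotentD_orth]. *)
Lemma jorthosystem_split k (c : 'I_k -> E) i a b : jorthosystem c ->
  jidempotent J a -> jidempotent J b -> a != 0 -> b != 0 -> c i = a + b ->
  jorthosystem (fun j : 'I_k.+1 =>
    if unlift ord0 j is Some j' then (if j' == i then a else c j') else b).
Proof.
move=> [cc orth sc] aa bb a0 b0 ci.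
have ab : a ** b = 0 by apply: jidempotentD => //; rewrite -ci; case: (cc i).
have abj j : j != i -> a ** c j = 0 /\ b ** c j = 0.
  move=> ji; have [cj _] := cc j; apply: jidempotentD_orth => //.
  by rewrite -ci orth// eq_sym.
have aj j : j != i -> a ** c j = 0 by move=> /abj[].
have bj j : j != i -> b ** c j = 0 by move=> /abj[].
split.
- by move=> j; case: unliftP => [j' _|_] //; case: eqP.
- move=> j j'; case: unliftP => [u ->|->]; case: unliftP => [u' ->|->].
  + rewrite (inj_eq lift_inj) => uu'; case: (eqVneq u i) => [ui|ui].
      by have u'i : u' != i; [rewrite -ui eq_sym | rewrite (negbTE u'i) aj].
    by case: (eqVneq u' i) => [_|_]; [rewrite jmulC aj | exact: orth].
  + by case: (eqVneq u i) => [//|ui _]; rewrite jmulC bj.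
  + by case: (eqVneq u' i) => [_ _|ui _]; [rewrite jmulC | rewrite bj].
  + by rewrite eqxx.
- rewrite big_ord_recl unlift_none; under eq_bigr do rewrite liftK.
  rewrite (bigD1 i)//= eqxx addrA [b + a]addrC -ci -sc [RHS](bigD1 i)//=.
  by congr (_ + _); apply: eq_bigr => j /negbTE ->.
Qed.

Lemma jorthosystem_refine k (c : 'I_k -> E) (l : 'I_k -> R) : jorthosystem c ->
  exists k' (c' : {ffun 'I_k' -> E}) (l' : 'I_k' -> R),
    jordan_frame J c' /\ \sum_i l i *: c i = \sum_i l' i *: c' i.
Proof.
(* Splitting terminates because an orthosystem has at most [n] members, so [n - k] decreases. *)
have [N] := ubnP (n - k); elim: N k c l => // N IH k c l nk oc.
have [prim|/existsNP[i nprim]] := pselect (forall i, jprimitive J (c i)).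
  exists k, [ffun i => c i], l; have [_ orth sc] := oc; split.
    split => [i|i j ij|]; rewrite ?ffunE//; first exact: orth.
    by rewrite -sc; apply: eq_bigr => i _; rewrite ffunE.
  by apply: eq_bigr => i _; rewrite ffunE.
have [cc _ _] := oc; have [ci ci0] := cc i.
have [a [b [aa bb a0 b0 cab]]] : exists a b, [/\ jidempotent J a,
    jidempotent J b, a != 0, b != 0 & c i = a + b].
  by apply: contrapT => H; apply: nprim.
have oc' := jorthosystem_split oc aa bb a0 b0 cab.
(* Both pieces of [c i] inherit its coefficient. *)
pose l' (j : 'I_k.+1) := if unlift ord0 j is Some j' then l j' else l i.
have kn := jorthosystem_size oc'.
have [|k' [c' [l'' [fc' E']]]] := IH _ _ l' _ oc'.
  by rewrite subnS -ltnS prednK ?subn_gt0.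
exists k', c', l''; split => //; rewrite -E' big_ord_recl /l' unlift_none.
under [in RHS]eq_bigr do rewrite liftK.
rewrite (bigD1 i)//= [in RHS](bigD1 i)//= eqxx addrA -scalerDr [b + a]addrC -cab.
by congr (_ + _); apply: eq_bigr => j /negbTE ->.
Qed.

Lemma jordan_frame_decomposition x :
  exists k (c : {ffun 'I_k -> E}) (l : 'I_k -> R),
    jordan_frame J c /\ x = \sum_i l i *: c i.
Proof.
have [k [c [l [cc orth sc xc _]]]] := jlagrange J x.
(* [jlagrange] does not assert that its idempotents are nonzero, so any zero ones are dropped. *)
pose P := [pred i | c i != 0]; pose c' (i : 'I_#|P|) := c (enum_val i).
have dropP (F : 'I_k -> E) : (forall i, c i = 0 -> F i = 0) ->
    \sum_i F i = \sum_(i < #|P|) F (enum_val i).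
  move=> F0; rewrite -big_enum_val [RHS]big_mkcond; apply: eq_bigr => i _.
  by rewrite inE; case: eqP => // /F0.
have oc' : jorthosystem c'.
  split.
  - by move=> i; split; [exact: cc | have := enum_valP i; rewrite inE].
  - by move=> i j ij; apply: orth; rewrite (inj_eq enum_val_inj).
  - by rewrite -sc (dropP c).
have [k' [c'' [l' [fc E']]]] := jorthosystem_refine (l \o enum_val) oc'.
exists k', c'', l'; split=> //; rewrite -E'.
rewrite -(dropP (fun i => l i *: c i)) => [|i ->]; last by rewrite scaler0.
by rewrite -[LHS](jmul1r J) -sc jmul_sumr; apply: eq_bigr.
Qed.

Lemma jordan_frame_orthosystem k (c : {ffun 'I_k -> E}) :
  jordan_frame J c -> jorthosystem c.
Proof. by move=> [pc orth sc]; split => // i; have [] := pc i. Qed.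

Lemma jorthosystem_jev k (c : 'I_k -> E) (l : 'I_k -> R) p :
  jorthosystem c -> jev J (\sum_i l i *: c i) p = \sum_i p.[l i] *: c i.
Proof.
move=> [cc orth sc]; elim/poly_ind: p => [|p t IH].
  by rewrite jev0 big1// => i _; rewrite horner0 scale0r.
rewrite jevD jevMX jevC IH -sc scaler_sumr jmul_suml -big_split.
apply: eq_bigr => i _ /=; rewrite jmul_sumr (bigD1 i)//= big1 ?addr0.
  rewrite jmulZl jmulZr; have [-> _] := cc i.
  by rewrite scalerA -scalerDl !hornerE [l i * _]mulrC.
by move=> j ji; rewrite jmulZl jmulZr orth 1?eq_sym// !scaler0.
Qed.

Lemma jorthosystem_jdegree_le k (c : 'I_k -> E) (l : 'I_k -> R) :
  jorthosystem c -> (jdegree J (\sum_i l i *: c i) <= k)%N.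
Proof.
move=> oc; apply: (@jdegree_leq _ _ _ _ (\prod_(i < k) ('X - (l i)%:P))).
- by rewrite monic_neq0// monic_prod_XsubC.
- by rewrite -big_enum/= size_prod_XsubC -cardE card_ord.
- rewrite jorthosystem_jev// big1// => i _.
  by rewrite horner_prod (bigD1 i)//= !hornerE subrr mul0r scale0r.
Qed.

Lemma jorthosystem_jdegree k (c : 'I_k -> E) (l : 'I_k -> R) :
  jorthosystem c -> injective l -> jdegree J (\sum_i l i *: c i) = k.
Proof.
move=> oc linj; apply/eqP; rewrite eqn_leq jorthosystem_jdegree_le//=.
have [p [p0 sp]] := jdegree_annihilator J (\sum_i l i *: c i).
rewrite jorthosystem_jev// => pl; rewrite -ltnS (leq_trans _ sp)//.
(* By orthogonality every [p.[l i]] is 0, so [p] has [k] distinct roots and degree at least [k]. *)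
have := @max_poly_roots _ p [seq l i | i <- enum 'I_k] p0.
rewrite size_map -cardE card_ord; apply.
  apply/allP => _ /mapP[i _ ->].
  by apply/rootP; exact: (jorthosystem_coef (l := fun i => p.[l i]) i oc pl).
by rewrite map_inj_uniq// enum_uniq.
Qed.

Lemma jordan_frame_jrank k (c : {ffun 'I_k -> E}) :
  jordan_frame J c -> jrank J = k.
Proof.
move=> fc; have oc := jordan_frame_orthosystem fc.
apply/eqP; rewrite eqn_leq; apply/andP; split.
  apply/bigmax_leqP => d /asboolP[x <-].
  have [k' [c' [l [fc' ->]]]] := jordan_frame_decomposition x.
  rewrite (jordan_frame_size fc fc'); apply: jorthosystem_jdegree_le.
  exact: jordan_frame_orthosystem.
have kn : (k < n.+1)%N by rewrite ltnS; exact: jorthosystem_size oc.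
apply: (@leq_bigmax_cond _ _ _ (Ordinal kn)); apply/asboolP.
(* The pairwise distinct coefficients 0, ..., k - 1 make the degree exactly [k]. *)
exists (\sum_(i < k) (i%:R : R) *: c i).
apply: (@jorthosystem_jdegree _ _ (fun i : 'I_k => i%:R) oc).
by move=> i j /eqP; rewrite eqr_nat => /eqP/val_inj.
Qed.

Theorem jordan_spectral x : exists (c : {ffun 'I_(jrank J) -> E})
    (l : 'I_(jrank J) -> R),
  jordan_frames J c /\ x = \sum_i l i *: c i.
Proof.
have [k [c [l [fc ->]]]] := jordan_frame_decomposition x.
have rk := jordan_frame_jrank fc; move: c l fc; rewrite -rk => c l fc.
by exists c, l.
Qed.

End Frames.

(** * Coordinatewise continuity and closedness of the symmetric tensors *)

Section TensorTopology.
Context {R : realType} {k m : nat}.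
Local Notation index := {ffun 'I_m -> 'I_k}.

Lemma tensor_coord_continuous (I : index) :
  continuous (fun A : tensor R k m => A I).
Proof. exact: (@proj_continuous _ (fun _ : index => R^o) I). Qed.

Lemma tensor_continuous (T : topologicalType) (f : T -> tensor R k m) :
  (forall I, continuous (fun x => f x I)) -> continuous f.
Proof.
move=> fI x; apply/cvg_sup => I.
exact: (@continuous_comp_initial _ _ _ (fun A : tensor R k m => A I : R^o) f (fI I)).
Qed.

Lemma closed_symtensor : closed (symtensor R k m).
Proof.
have -> : symtensor R k m = \bigcap_(s in [set: 'S_m]) \bigcap_(I in [set: index])
    ((fun A : tensor R k m => (A [ffun j => I (s j)] - A I : R^o)) @^-1` [set 0]).
  rewrite eqEsubset; split => A /= HA => [s _ I _ /=|s I].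
    by rewrite HA subrr.
  by apply/eqP; rewrite -subr_eq0; apply/eqP; exact: HA.
apply: closed_bigI => s _; apply: closed_bigI => I _.
have sub_cont : continuous (fun A : tensor R k m => (A [ffun j => I (s j)] - A I : R^o)).
  move=> A; exact: (@cvgB R R^o _ (nbhs A) _ _ _ _ _
    (@tensor_coord_continuous _ A) (@tensor_coord_continuous I A)).
by apply: preimage_closed; [move=> A _; exact: sub_cont | exact: closed_eq].
Qed.

End TensorTopology.

(** * The map sending a tensor to its array in a frame *)

Section FrameTensor.
Context {R : realType} {E : vectType R} (J : euclidean_jordan E) {m : nat}.
Local Notation "x ** y" := (jmul J x y) (at level 40, left associativity).
Local Notation n := (\dim {:E}).
Local Notation b := (vbasis {:E}).
Implicit Types (A B : tensor R n m).

(** The sum over the second multi-index factors into one sum per slot, each reassembling [x j] from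
    its coordinates. The result is visibly linear in [A]. *)
Lemma jtdot_jtpure A (x : 'I_m -> E) :
  jtdot J A (jtpure x) = \sum_L A L * \prod_j jdot J b`_(L j) (x j).
Proof.
rewrite /jtdot; apply: eq_bigr => L _.
under [LHS]eq_bigr do rewrite -mulrA.
rewrite -mulr_sumr; congr (_ * _).
under [RHS]eq_bigr => j _.
  rewrite {1}(coord_vbasis (memvf (x j))) jdot_sumr.
  under eq_bigr do rewrite jdotZr.
  over.
rewrite bigA_distr_bigA; apply: eq_bigr => K _.
by rewrite /jtpure /tpure -big_split; apply: eq_bigr => j _; rewrite mxE.
Qed.

Lemma frame_tensorE k A (c : {ffun 'I_k -> E}) I :
  frame_tensor J A c I = \sum_L A L * \prod_j jdot J b`_(L j) (c (I j)).
Proof. exact: jtdot_jtpure. Qed.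

Lemma frame_tensor0 k (c : {ffun 'I_k -> E}) : frame_tensor J (0 : tensor R n m) c = 0.
Proof.
by apply/funext => I; rewrite frame_tensorE big1// => L _; rewrite mul0r.
Qed.

Lemma frame_tensorD k A B (c : {ffun 'I_k -> E}) :
  frame_tensor J (A + B) c = frame_tensor J A c + frame_tensor J B c.
Proof.
apply/funext => I; rewrite -[RHS]/(frame_tensor J A c I + frame_tensor J B c I).
rewrite !frame_tensorE -big_split; apply: eq_bigr => L _.
by rewrite -[(A + B) L]/(A L + B L) mulrDl.
Qed.

Lemma frame_tensorZ k (r : R) A (c : {ffun 'I_k -> E}) :
  frame_tensor J (r *: A) c = r *: frame_tensor J A c.
Proof.
apply/funext => I; rewrite -[RHS]/(r * frame_tensor J A c I).
by rewrite !frame_tensorE mulr_sumr; apply: eq_bigr => L _; rewrite mulrA.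
Qed.

Lemma frame_tensor_continuous k (c : {ffun 'I_k -> E}) :
  continuous (fun A => frame_tensor J A c).
Proof.
apply: tensor_continuous => I.
have -> : (fun A => frame_tensor J A c I) =
    fun A => \sum_L A L * \prod_j jdot J b`_(L j) (c (I j)).
  by apply/funext => A; exact: frame_tensorE.
apply: (@continuous_big R^o _ +%R 0 xpredT) => [|L _ A].
  exact: (@add_continuous R^o).
exact: (@cvgMr_tmp _ _ (nbhs A) _ _ _ _ (@tensor_coord_continuous _ _ _ L A)).
Qed.

(** A permutation of the slots of [I] is absorbed by the same permutation of the summation index
    [L]. *)
Lemma frame_tensor_sym k A (c : {ffun 'I_k -> E}) :
  symtensor R n m A -> symtensor R k m (frame_tensor J A c).
Proof.
move=> symA s I; rewrite !frame_tensorE.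
pose act (s : 'S_m) (L : {ffun 'I_m -> 'I_n}) := [ffun j => L (s j)].
rewrite (reindex (act s)) /=; last first.
  by exists (act (s^-1)%g) => L _; apply/ffunP => j; rewrite !ffunE ?permK ?permKV.
apply: eq_bigr => L _; rewrite symA; congr (_ * _).
rewrite [RHS](reindex_inj (@perm_inj _ s)).
by apply: eq_bigr => j _; rewrite !ffunE.
Qed.

Lemma tdot_frame_tensor k A (c : {ffun 'I_k -> E}) (x : 'rV[R]_k) :
  tdot (frame_tensor J A c) (tpure (fun=> x)) =
  jtdot J A (jtpure (fun=> \sum_i x 0 i *: c i)).
Proof.
rewrite jtdot_jtpure /tdot; under eq_bigr do rewrite frame_tensorE mulr_suml.
rewrite exchange_big; apply: eq_bigr => L _ /=.
under [LHS]eq_bigr do rewrite -mulrA.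
rewrite -mulr_sumr; congr (_ * _).
under [RHS]eq_bigr => j _.
  rewrite jdot_sumr; under eq_bigr do rewrite jdotZr.
  over.
rewrite bigA_distr_bigA; apply: eq_bigr => I _.
by rewrite /tpure -big_split; apply: eq_bigr => j _; rewrite mulrC.
Qed.

(** Used in both directions: nonnegative combinations of a frame are squares, and squares are such
    combinations. *)
Lemma jorthosystem_sqr k (c : 'I_k -> E) (l : 'I_k -> R) : jorthosystem J c ->
  (\sum_i l i *: c i) ** (\sum_i l i *: c i) = \sum_i l i ^+ 2 *: c i.
Proof.
move=> [cc orth _]; rewrite jmul_suml; apply: eq_bigr => i _.
rewrite jmul_sumr (bigD1 i)//= big1 ?addr0 => [|j ji].
  by rewrite jmulZl jmulZr; have [-> _] := cc i; rewrite scalerA.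
by rewrite jmulZl jmulZr orth 1?eq_sym// !scaler0.
Qed.

(** The conditions are preimages of [O] under continuous linear maps; [O 0] puts the zero tensor in
    all of them, so their intersection is nonempty. *)
Lemma jordan_outer_cone k (F : set {ffun 'I_k -> E}) (O : set (tensor R k m)) :
  closed_convex_cone O -> O 0 -> closed_convex_cone (jordan_outer J F O).
Proof.
move=> [cO vO [_ sO]] O0; split.
- apply: closedI; first exact: closed_symtensor.
  apply: closed_bigI => c _; apply: preimage_closed => //.
  by move=> A _; exact: frame_tensor_continuous.
- move=> A B t /set_mem[sA FA] /set_mem[sB FB]; apply/mem_set; split.
    by move=> s I; congr (_ * _ + _ * _); [exact: sA|exact: sB].
  move=> c Fc.
  have := vO _ _ t (mem_set (FA c Fc)) (mem_set (FB c Fc)) => /set_mem.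
  congr (O _); rewrite /conv/=.
  by rewrite frame_tensorD !frame_tensorZ.
- split.
    exists 0; split => [s I //|c Fc].
    by rewrite /= frame_tensor0.
  move=> r A r0 [sA FA]; split => [s I|c Fc].
    by congr (_ * _); exact: sA.
  by rewrite /= frame_tensorZ; apply: sO => //; exact: FA.
Qed.

End FrameTensor.

Theorem proposition4p9 (R : realType) (E : vectType R)
  (J : euclidean_jordan E) (m : nat) (hm : (1 <= m)%N)
  (O : nat -> set (tensor R (jrank J) m))
  (hO_sub : forall r, O r `<=` symtensor R (jrank J) m)
  (hO_cone : forall r, closed_convex_cone (O r))
  (hO_decr : forall r, O r.+1 `<=` O r)
  (hO_cap : COP R (jrank J) m = \bigcap_r O r)
  (Fc F : set {ffun 'I_(jrank J) -> E})
  (hFc : complete_representatives (jordan_frames J) Fc)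
  (hFcF : Fc `<=` F)
  (hF : F `<=` jordan_frames J) :
  [/\ forall r, closed_convex_cone (jordan_outer J F (O r)),
      forall r, jordan_outer J F (O r.+1) `<=` jordan_outer J F (O r)
    & jCOP J m = \bigcap_r jordan_outer J F (O r)].
Proof.
have O0 r : O r 0.
  have : COP R (jrank J) m 0.
    by split => // x _; rewrite /tdot big1// => I _; rewrite mul0r.
  by rewrite hO_cap; apply.
split=> [r|r A [sA FA]|]; first exact: jordan_outer_cone.
  by split => // c cF; exact: hO_decr (FA c cF).
rewrite eqEsubset; split => [A [sA posA] r _|A FA].
  split => // c cF /=; have oc := jordan_frame_orthosystem (hF _ cF).
  suff : COP R (jrank J) m (frame_tensor J A c) by rewrite hO_cap; apply.
  split; first exact: frame_tensor_sym.
  move=> x x0; rewrite tdot_frame_tensor; apply: posA.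
  (* Square roots of the nonnegative coordinates exhibit the point as a square. *)
  exists (\sum_i Num.sqrt (x 0 i) *: c i); rewrite jorthosystem_sqr//.
  by apply: eq_bigr => i _; rewrite sqr_sqrtr.
have [sA _] := FA 0%N I; split => // _ [y ->].
have [c [l [fc ->]]] := jordan_spectral J y.
rewrite (jorthosystem_sqr _ (jordan_frame_orthosystem fc)).
(* The frame of [y] may lie outside [F], but a reordering [c'] of it lies in [Fc]; the coefficients
   are permuted by the same [s]. *)
have [c' [[Fc' [s c'E]] _]] := hFc.2 c fc.
have : COP R (jrank J) m (frame_tensor J A c').
  by rewrite hO_cap => r _; have [_] := FA r I; apply; exact: hFcF.
move=> [_ /(_ (\row_i l (s i) ^+ 2))]; rewrite tdot_frame_tensor.
have -> : \sum_i (\row_i l (s i) ^+ 2) 0 i *: c' i = \sum_i l i ^+ 2 *: c i.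
  rewrite [RHS](reindex_inj (@perm_inj _ s)); apply: eq_bigr => i _.
  by rewrite mxE c'E ffunE.
by apply=> i; rewrite mxE sqr_ge0.
Qed.
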